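(* Let $\mathcal{F}$ be a stable foliation on $\mathbb{CP}^2$ of degree $d\ge 2$ with isolated singularities. Then $\mathcal{F}$ has a singular point with algebraic multiplicity less than $\frac{2d+1}{3}$.
   Context: Let $W_d$ be the complex vector space of homogeneous vector fields $P\,\partial/\partial x+Q\,\partial/\partial y+R\,\partial/\partial z$ with $P,Q,R\in\mathbb{C}[x,y,z]$ homogeneous of degree $d$, modulo the fields $G\cdot(x\,\partial/\partial x+y\,\partial/\partial y+z\,\partial/\partial z)$ with $G$ homogeneous of degree $d-1$. A foliation of degree $d$ on $\mathbb{CP}^2$ is a point of $\mathcal{F}(d;2)=\mathbb{P}(W_d)\cong\mathbb{CP}^{d^2+4d+2}$. The group $SL_3(\mathbb{C})$ acts linearly by $g\cdot X=Dg\,X(g^{-1})$. A point $p\in\mathbb{CP}^2$ is a singular point of the foliation defined by $X$ if $X(p)=\alpha p$ for some $\alpha\in\mathbb{C}$ (as vectors in $\mathbb{C}^3$). In the affine chart $x=1$ around $[1:0:0]$ the foliation is represented by the local vector field $f\,\partial/\partial y+g\,\partial/\partial z$, where $f=Q(1,y,z)-yP(1,y,z)$ and $g=R(1,y,z)-zP(1,y,z)$; similarly, by a linear change of coordinates, at every point. The algebraic multiplicity at a singular point $p$, translated to the origin of the chart, is the minimum of the orders of vanishing of $f$ and $g$ at the origin. For a one-parameter subgroup (1-PS) $\lambda:\mathbb{C}^*\to SL_3(\mathbb{C})$, choose a basis $\nu_0,\dots,\nu_n$ of $W_d$ with $\lambda(t)\nu_i=t^{r_i}\nu_i$, $r_i\in\mathbb{Z}$.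 For a foliation represented by $\sum a_i\nu_i$, the Mumford function is $\mu(\mathcal{F},\lambda)=\min\{r_i: a_i\ne 0\}$. The foliation $\mathcal{F}$ is stable if $\mu(\mathcal{F},\lambda)<0$ for every non-trivial 1-PS $\lambda$ of $SL_3(\mathbb{C})$. *)

(* Defs.v *)
From HB Require Import structures.
From mathcomp Require Import all_boot all_order all_algebra.
From mathcomp Require Import reals complex mpoly.

Set Implicit Arguments.
Unset Strict Implicit.
Unset Printing Implicit Defensive.

Import Order.TTheory GRing.Theory Num.Theory.
Local Open Scope ring_scope.

(* With R : realType, C := R[i] is the field of complex numbers.  The
   coordinates x, y, z are 'X_0, 'X_1, 'X_2, and the vector field
   P d/dx + Q d/dy + R d/dz is the column vector (P, Q, R). *)
Definition vfield (R : realType) : Type := 'cV[{mpoly R[i][3]}]_3.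

Definition homogeneous_vfield (R : realType) (d : nat) (X : vfield R) : Prop :=
  forall i, X i 0 \is d.-homog.

Definition radial (R : realType) : vfield R := \col_i 'X_i.

(* Equality of the classes of X and Y in W_d.  The zero polynomial is
   homogeneous of every degree, so G = 0 is allowed. *)
Definition eqW (R : realType) (d : nat) (X Y : vfield R) : Prop :=
  exists2 G : {mpoly R[i][3]}, G \is d.-1.-homog & X - Y = G *: radial R.

(* X represents a point of P(W_d). *)
Definition foliation (R : realType) (d : nat) (X : vfield R) : Prop :=
  homogeneous_vfield d X /\ ~ eqW d X 0.

(* The linear forms (h x)_0, (h x)_1, (h x)_2. *)
Definition linear_forms (R : realType) (h : 'M[R[i]]_3)
  : 3.-tuple {mpoly R[i][3]} :=
  [tuple \sum_(j < 3) (h i j)%:MP * 'X_j | i < 3].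

(* g . X = Dg X(g^-1); the differential Dg of a linear map is g itself. *)
Definition act (R : realType) (g : 'M[R[i]]_3) (X : vfield R) : vfield R :=
  map_mx (@mpolyC 3 R[i]) g
    *m map_mx (fun p => p \mPo linear_forms (invmx g)) X.

(* Points of CP^2 are given by nonzero vectors, up to proportionality. *)
Definition eval (R : realType) (X : vfield R) (p : 'cV[R[i]]_3)
  : 'cV[R[i]]_3 := map_mx (meval (fun j => p j 0)) X.

Definition singular_point (R : realType) (X : vfield R) (p : 'cV[R[i]]_3)
  : Prop :=
  p != 0 /\ exists a : R[i], eval X p = a *: p.

(* Every singular point is isolated in the singular set for the topology of
   CP^2: the images in CP^2 of the balls centred at the vector p form a basis
   of neighbourhoods of [p].  (0 < e in R[i] forces e to be real.) *)
Definition isolated_singularities (R : realType) (X : vfield R) : Prop :=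
  forall p : 'cV[R[i]]_3, singular_point X p ->
    exists2 e : R[i], 0 < e &
      forall q : 'cV[R[i]]_3, singular_point X q ->
        (forall i, `|q i 0 - p i 0| < e) -> exists c : R[i], q = c *: p.

(* h(1, y, z), where y and z are the variables 'X_0 and 'X_1. *)
Definition dehomogenize (R : realType) (h : {mpoly R[i][3]})
  : {mpoly R[i][2]} :=
  h \mPo [tuple 1; 'X_0; 'X_1].

Definition chart_f (R : realType) (X : vfield R) : {mpoly R[i][2]} :=
  dehomogenize (X 1 0) - 'X_0 * dehomogenize (X 0 0).

Definition chart_g (R : realType) (X : vfield R) : {mpoly R[i][2]} :=
  dehomogenize (X 2 0) - 'X_1 * dehomogenize (X 0 0).

(* Order of vanishing at the origin; None stands for +oo.  As msize h exceeds
   the degree of every monomial of h, it does not affect the minimum. *)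
Definition order0 (R : realType) (h : {mpoly R[i][2]}) : option nat :=
  if h == 0 then None
  else Some (\big[minn/msize h]_(k <- msupp h) mdeg k).

Definition omin (a b : option nat) : option nat :=
  match a, b with
  | Some m, Some n => Some (minn m n)
  | Some m, None => Some m
  | None, _ => b
  end.

(* The linear change of coordinates g takes [1:0:0] to [p]; in the new
   coordinates the foliation is given by g^-1 . X.  The value m does not depend
   on the choice of g, nor on that of the vector p. *)
Definition algebraic_multiplicity (R : realType) (X : vfield R)
    (p : 'cV[R[i]]_3) (m : nat) : Prop :=
  exists g : 'M[R[i]]_3,
    [/\ g \in unitmx, g *m delta_mx 0 0 = p
      & let Y := act (invmx g) X in
        omin (order0 (chart_f Y)) (order0 (chart_g Y)) = Some m].

(* A morphism of algebraic groups C^* -> SL_3(C): the entries of l t are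
   Laurent polynomials in t.  The value of l at 0 is irrelevant. *)
Definition one_ps (R : realType) (l : R[i] -> 'M[R[i]]_3) : Prop :=
  [/\ forall t, t != 0 -> \det (l t) = 1,
      forall s t, s != 0 -> t != 0 -> l (s * t) = l s *m l t
    & exists (A : 'M[{poly R[i]}]_3) (N : nat),
        forall t, t != 0 -> l t = t ^- N *: map_mx (fun q => q.[t]) A].

Definition nontrivial_ps (R : realType) (l : R[i] -> 'M[R[i]]_3) : Prop :=
  exists2 t, t != 0 & l t != 1%:M.

(* The classes of nu_0, ..., nu_(N-1) form a basis of W_d. *)
Definition basisW (R : realType) (d N : nat) (nu : 'I_N -> vfield R) : Prop :=
  [/\ forall i, homogeneous_vfield d (nu i),
      forall X, homogeneous_vfield d X ->
        exists a : 'I_N -> R[i], eqW d X (\sum_i (a i)%:MP *: nu i)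
    & forall a : 'I_N -> R[i],
        eqW d (\sum_i (a i)%:MP *: nu i) 0 -> forall i, a i = 0].

(* m = mu(F, l), where F is the foliation represented by X; m does not depend
   on the choice of the basis nu. *)
Definition mumford (R : realType) (d : nat) (X : vfield R)
    (l : R[i] -> 'M[R[i]]_3) (m : int) : Prop :=
  exists (N : nat) (nu : 'I_N -> vfield R) (r : 'I_N -> int)
         (a : 'I_N -> R[i]),
    [/\ basisW d nu,
        forall t i, t != 0 -> eqW d (act (l t) (nu i)) ((t ^ r i)%:MP *: nu i),
        eqW d X (\sum_i (a i)%:MP *: nu i),
        exists2 i, a i != 0 & r i = m
      & forall i, a i != 0 -> m <= r i].

Definition stable (R : realType) (d : nat) (X : vfield R) : Prop :=
  forall l : R[i] -> 'M[R[i]]_3, one_ps l -> nontrivial_ps l ->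
    exists2 m : int, mumford d X l m & m < 0.

(* Main.v *)
Require Import Defs.
From HB Require Import structures.
From mathcomp Require Import all_boot all_order all_algebra.
From mathcomp Require Import reals complex mpoly.
From mathcomp Require Import perm ring zify.

Set Implicit Arguments.
Unset Strict Implicit.
Unset Printing Implicit Defensive.

Import Order.TTheory GRing.Theory Num.Theory.
Local Open Scope ring_scope.

(** In fact every singular point of a stable foliation has multiplicity less
    than (2d+1)/3, and every foliation has a singular point.

    Multiplicity.  Move the singular point to [1:0:0], where its multiplicity
    is n, and act by diag(t^2, t^-1, t^-1).  Subtracting a multiple of the
    Euler field (exists_reduced), the component P may be assumed to be free
    of x, and then a monomial of degree s in (y, z) occurs in Q or R only if
    s >= n.  Its weight is -1 - 2(d - s) + s = 3s - (2d + 1), and the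
    monomials of P have weight d + 2.  So if 3n >= 2d + 1 no negative weight
    occurs (weight_ge0), and the Mumford function is nonnegative whatever
    eigenbasis computes it (nonneg_weights_push): the foliation is not stable.
    The multiplicity is finite because a field with f = g = 0 in the chart is
    a multiple of the Euler field (local_eq0).

    Existence of a singular point (exists_parallel).  Put T = yR - zQ,
    U = yP - xQ, and V = (x - ay)R - z(P - aQ), with coordinates such that
    R(1,0,0) <> 0; thus V is, up to a constant, monic in x of degree d + 1,
    and

      (x - ay) T = z U   wherever V = 0.

    For a form q, let N_q(y,z) be the product of the values of q at the roots
    x of V(x,y,z); it is the norm of q along the projection of the curve
    V = 0 from [1:0:0], and it is polynomial and homogeneous in (y,z).
    A zero of N_T with z <> 0 is a singular point.  If there is none, then
    N_T = c z^((d+1)^2), so multiplicativity of the norm gives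
    N_U = c z^(d(d+1)) N_(x-ay), which vanishes at (1,0).  Hence V = U = 0 at
    some point (x,1,0), where V is proportional to (x - a) R.  If a is
    chosen as a root of R(x,1,0), this forces R(x,1,0) = 0, and together with
    U = 0 it makes (x,1,0) singular. *)

(** * Norms of polynomials over a parameter *)

Lemma prodr_scale (F : comNzRingType) (I : Type) (r : seq I) (c : F)
    (G : I -> F) :
  \prod_(i <- r) (c * G i) = c ^+ size r * \prod_(i <- r) G i.
Proof.
rewrite big_split big_const_seq count_predT; congr (_ * _).
by elim: (size r) => //= k ->; rewrite exprS.
Qed.

Lemma horner_char_poly (F : comNzRingType) n (M : 'M[F]_n) (z : F) :
  (char_poly M).[z] = \det (z%:M - M).
Proof.
rewrite -[LHS]/(horner_eval z (char_poly M)) /char_poly -det_map_mx.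
congr (\det _); apply/matrixP=> i j; rewrite !mxE /= /horner_eval !hornerE.
by case: (i == j); rewrite ?mulr1n ?mulr0n ?hornerX ?horner0.
Qed.

(** Both sides are multiplicative in q, so it suffices to treat linear
    factors, where this is the value of the characteristic polynomial. *)
Lemma det_horner_mx (F : closedFieldType) n (M : 'M[F]_n.+1) rs (q : {poly F}) :
  char_poly M = \prod_(x <- rs) ('X - x%:P) ->
  \det (horner_mx M q) = \prod_(x <- rs) q.[x].
Proof.
move=> cM; have szrs : size rs = n.+1.
  have := size_char_poly M; rewrite cM size_prod_XsubC; by case.
have [r ->] := closed_field_poly_normal q.
rewrite linearZ detZ /=.
under [RHS]eq_bigr do rewrite hornerZ.
rewrite prodr_scale szrs; congr (_ * _).
elim: r => [|z r IHr].
  rewrite !big_nil rmorph1 det1 big1_seq // => x _; exact: hornerC.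
rewrite big_cons rmorphM det_mulmx IHr.
under [in RHS]eq_bigr do rewrite hornerM.
rewrite big_split /=; congr (_ * _).
rewrite rmorphB /= horner_mx_X horner_mx_C -opprB -scaleN1r detZ.
rewrite -horner_char_poly cM horner_prod -szrs.
elim: rs {cM szrs IHr} => [|x s IHs]; first by rewrite !big_nil mulr1.
rewrite !big_cons -IHs /= exprS !hornerXsubC.
by rewrite [in LHS]mulrACA mulN1r opprB.
Qed.

(** The product of q over the roots of V is a symmetric function of the roots,
    hence polynomial in the coefficients.  Here this is seen by writing it as
    the determinant of q evaluated at a companion matrix of V, whose entries
    are polynomial in the parameter s. *)
Lemma poly_norm (F : closedFieldType) (V q : {poly {poly F}}) :
  V \is monic -> (1 < size V)%N ->
  exists N : {poly F}, forall s rs,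
    map_poly (horner_eval s) V = \prod_(x <- rs) ('X - x%:P) ->
    N.[s] = \prod_(x <- rs) (map_poly (horner_eval s) q).[x].
Proof.
move=> monV szV.
have [n [M cM]] : exists n (M : 'M[{poly F}]_n.+1), char_poly M = V.
  have : exists M : 'M[{poly F}]_((size V).-1), char_poly M = V.
    by exists (companionmx V); apply: companionmxK.
  by case: (size V) szV => [|[|n]] // _; exists n.
exists (\det (horner_mx M q)) => s rs Vrs.
rewrite -[LHS]/(horner_eval s _) -det_map_mx map_horner_mx.
by apply: det_horner_mx; rewrite -map_char_poly cM.
Qed.

(** * Norms of forms along the projection from [1:0:0] *)

Lemma meval_dhomog (F : comNzRingType) n d (h : {mpoly F[n]}) (c : F) v :
  h \is d.-homog -> h.@[fun i => c * v i] = c ^+ d * h.@[v].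
Proof.
move=> /dhomogP hd; rewrite !mevalE mulr_sumr !big_seq.
apply: eq_bigr => m /hd <-; rewrite mulrCA; congr (_ * _).
under eq_bigr do rewrite exprMn.
by rewrite big_split /= prodrXr mdegE.
Qed.

Definition triple (T : Type) (x y z : T) : 'I_3 -> T := tnth [tuple x; y; z].

(** The form h on the line (x, u, v), as a polynomial in x.  The target ring K
    is F for a fixed line and {poly F} for a one-parameter family of lines. *)
Definition slice (F K : comNzRingType) (f : {rmorphism F -> K}) (u v : K)
    (h : {mpoly F[3]}) : {poly K} :=
  mmap (polyC \o f) (triple 'X u%:P v%:P) h.

Definition slice_at (F : comNzRingType) (y z : F) := slice idfun y z.

Lemma horner_slice_at (F : comNzRingType) (y z x : F) h :
  (slice_at y z h).[x] = h.@[triple x y z].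
Proof.
rewrite mevalE /slice_at /slice /mmap horner_sum; apply: eq_bigr => m _.
rewrite hornerM hornerC /mmap1 horner_prod /=; congr (_ * _).
apply: eq_bigr => i _; rewrite horner_exp; congr (_ ^+ _).
by case: i => -[|[|[|]]] //= i; rewrite /triple !(tnth_nth 0) /=;
  rewrite ?hornerX ?hornerC.
Qed.

Lemma map_slice (F : comNzRingType) (u v : {poly F}) (s : F) h :
  map_poly (horner_eval s) (slice polyC u v h) = slice_at u.[s] v.[s] h.
Proof.
rewrite /slice_at /slice /mmap rmorph_sum; apply: eq_bigr => m _.
rewrite rmorphM /= map_polyC; congr (_ * _).
  by rewrite /= /horner_eval hornerC.
rewrite /mmap1 rmorph_prod; apply: eq_bigr => i _; rewrite rmorphXn /=.
congr (_ ^+ _); case: i => -[|[|[|]]] //= i; rewrite /triple !(tnth_nth 0) /=.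
- by rewrite map_polyX.
- by rewrite map_polyC.
- by rewrite map_polyC.
Qed.

(** The coefficient of x^d in a form of degree d is a constant, its value at
    [1:0:0]; so a form that does not vanish there is monic in x up to scaling
    on every line through that point. *)
Lemma slice_dhomog (F K : comNzRingType) (f : {rmorphism F -> K}) u v d h :
  h \is d.-homog ->
  (size (slice f u v h) <= d.+1)%N /\ (slice f u v h)`_d = f h.@[triple 1 0 0].
Proof.
move=> /dhomogP hd.
have m1E (m : 'X_{1..3}) : mmap1 (triple 'X u%:P v%:P) m =
    'X^(m ord0) * (u ^+ m (inord 1) * v ^+ m (inord 2))%:P.
  rewrite /mmap1 !big_ord_recl big_ord0 mulr1 /triple !(tnth_nth 0) /=.
  rewrite polyCM !polyC_exp; congr (_ * (_ ^+ (m _) * _ ^+ (m _)));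
  by apply/val_inj; rewrite /= inordK.
have mdE m : m \in msupp h -> d = (m ord0 + (m (inord 1) + m (inord 2)))%N.
  move=> /hd <- /=; rewrite mdegE !big_ord_recl big_ord0 addn0.
  by congr (_ + (m _ + m _))%N; apply/val_inj; rewrite /= inordK.
split.
  apply: (leq_trans (size_sum _ _ _)); apply/bigmax_leqP_seq => m mh _ /=.
  rewrite m1E mulrCA mulrC -polyCM mul_polyC.
  apply: (leq_trans (size_scale_leq _ _)).
  by rewrite size_polyXn ltnS (mdE _ mh) leq_addr.
rewrite /slice /mmap coef_sum mevalE rmorph_sum /= big_seq [RHS]big_seq.
apply: eq_bigr => m mh.
rewrite coefCM rmorphM /= m1E coefMC coefXn; congr (_ * _).
rewrite !big_ord_recl big_ord0 mulr1 /triple !(tnth_nth 0) /= expr1n mul1r.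
have -> : lift ord0 ord0 = inord 1 :> 'I_3 by apply/val_inj; rewrite /= inordK.
have -> : lift ord0 (lift ord0 ord0) = inord 2 :> 'I_3.
  by apply/val_inj; rewrite /= inordK.
rewrite !expr0n rmorphM !rmorph_nat (mdE _ mh).
case: (m (inord 1)) => [|k]; last first.
  by rewrite !mul0r; case: eqP => [|_]; [lia | rewrite mul0r].
case: (m (inord 2)) => [|k]; last first.
  by rewrite !mulr0; case: eqP => [|_]; [lia | rewrite mul0r].
by rewrite !addn0 eqxx !mul1r !expr0.
Qed.

Lemma eq_poly_neq0 (F : numDomainType) (p q : {poly F}) :
  (forall s, s != 0 -> p.[s] = q.[s]) -> p = q.
Proof.
move=> pq; apply/eqP; rewrite -subr_eq0; apply/eqP.
apply: (@roots_geq_poly_eq0 _ _ [seq i.+1%:R | i <- iota 0 (size (p - q))]).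
- apply/allP => _ /mapP[i _ ->]; rewrite rootE hornerD hornerN pq ?subrr //.
  by rewrite pnatr_eq0.
- rewrite map_inj_uniq ?iota_uniq // => i j /eqP; rewrite eqr_nat => /eqP; lia.
- by rewrite size_map size_iota.
Qed.

Section FibreNorm.
Variables (F : numClosedFieldType) (n : nat) (V : {mpoly F[3]}).
Hypotheses (V_homog : V \is n.+1.-homog) (V_monic : V.@[triple 1 0 0] = 1).

Lemma slice_monic (K : comNzRingType) (f : {rmorphism F -> K}) u v :
  slice f u v V \is monic /\ size (slice f u v V) = n.+2.
Proof.
have [szV cV] := slice_dhomog f u v V_homog; rewrite V_monic rmorph1 in cV.
have sz : size (slice f u v V) = n.+2.
  apply/eqP; rewrite eqn_leq szV ltnNge; apply/negP => /leq_sizeP /(_ n.+1).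
  by rewrite cV leqnn => /(_ isT)/eqP; rewrite oner_eq0.
by split; rewrite // monicE lead_coefE sz cV.
Qed.

Definition fibre (y z : F) : seq F :=
  sval (closed_field_poly_normal (slice_at y z V)).

Lemma fibreE y z : slice_at y z V = \prod_(x <- fibre y z) ('X - x%:P).
Proof.
rewrite /fibre; case: closed_field_poly_normal => r /= {1}->.
by have [/monicP-> _] := slice_monic idfun y z; rewrite scale1r.
Qed.

Lemma size_fibre y z : size (fibre y z) = n.+1.
Proof.
have [_] := slice_monic idfun y z; rewrite -/(slice_at y z) fibreE.
by rewrite size_prod_XsubC => -[].
Qed.

Lemma mem_fibre x y z : (x \in fibre y z) = (V.@[triple x y z] == 0).
Proof. by rewrite -root_prod_XsubC -fibreE rootE horner_slice_at. Qed.

(** The norm of q from the curve V = 0 to the line of the (y, z). *)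
Definition norm (q : {mpoly F[3]}) (y z : F) : F :=
  \prod_(x <- fibre y z) q.@[triple x y z].

(** With u and v polynomial in s this covers both affine lines (s, 1) and
    (1, s) of the parameter space. *)
Lemma norm_poly q (u v : {poly F}) :
  exists N : {poly F}, forall s, N.[s] = norm q u.[s] v.[s].
Proof.
have [V1 szV] := slice_monic polyC u v.
have [|N NE] := poly_norm (slice polyC u v q) V1; first by rewrite szV.
exists N => s; rewrite (NE _ (fibre u.[s] v.[s])) ?map_slice ?fibreE //.
by apply: eq_bigr => x _; rewrite horner_slice_at.
Qed.

Lemma norm_eq0 q y z : norm q y z = 0 ->
  exists2 x, V.@[triple x y z] = 0 & q.@[triple x y z] = 0.
Proof.
move/eqP; rewrite prodf_seq_eq0 => /hasP[x]; rewrite mem_fibre => /eqP Vx /eqP.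
by exists x.
Qed.

Lemma scale_triple (s x y z : F) (h : {mpoly F[3]}) :
  h.@[triple (s * x) (s * y) (s * z)] = h.@[fun i => s * triple x y z i].
Proof. by apply: meval_eq; case=> -[|[|[|]]]. Qed.

(** Scaling (y, z) by s scales the roots of V by s, as V is homogeneous. *)
Lemma norm_homog k q s y z : q \is k.-homog -> s != 0 ->
  norm q (s * y) (s * z) = s ^+ (k * n.+1) * norm q y z.
Proof.
move=> q_homog s0.
have fibE : perm_eq (fibre (s * y) (s * z)) [seq s * x | x <- fibre y z].
  apply: prod_XsubC_eq; rewrite -fibreE big_map; apply: eq_poly_neq0 => t _.
  have -> : t = s * (s^-1 * t) by rewrite mulVKf.
  rewrite horner_slice_at scale_triple (meval_dhomog _ _ V_homog).
  rewrite -horner_slice_at fibreE !horner_prod -(size_fibre y z).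
  rewrite -prodr_scale; apply: eq_bigr => x _.
  by rewrite !hornerXsubC mulrBr.
rewrite /norm (perm_big _ fibE) big_map /= exprM -(size_fibre y z) -prodr_scale.
apply: eq_bigr => x _; by rewrite scale_triple (meval_dhomog _ _ q_homog).
Qed.
End FibreNorm.

(** * A homogeneous vector field is somewhere parallel to the position vector *)

(** The conclusion says that the 2 x 2 minors of (x, y, z) and (P, Q, R)
    vanish at some point other than [1:0:0].  See the opening comment for the
    argument; d > 0 is needed for R(x,1,0) to have a root and for N_U to
    vanish at (1,0). *)
Lemma exists_parallel (F : numClosedFieldType) d (P Q R : {mpoly F[3]}) :
  (0 < d)%N -> P \is d.-homog -> Q \is d.-homog -> R \is d.-homog ->
  R.@[triple 1 0 0] != 0 ->
  exists x y z : F,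
    [/\ (y != 0) || (z != 0),
        y * P.@[triple x y z] = x * Q.@[triple x y z],
        z * P.@[triple x y z] = x * R.@[triple x y z]
      & z * Q.@[triple x y z] = y * R.@[triple x y z]].
Proof.
move=> d0 Ph Qh Rh r0.
pose X i : {mpoly F[3]} := 'X_(inord i).
have Xh i : X i \is 1.-homog by rewrite dhomogX /= mdeg1.
have XE x y z : ((X 0%N).@[triple x y z] = x) * ((X 1%N).@[triple x y z] = y)
              * ((X 2).@[triple x y z] = z).
  by rewrite !mevalXU /triple !(tnth_nth 0) !inordK.
have Mh (l A : {mpoly F[3]}) : l \is 1.-homog -> A \is d.-homog ->
  l * A \is d.+1.-homog by exact: dhomogM.
have [a Ra] : exists a, R.@[triple a 1 0] = 0.
  have [szR cR] := slice_dhomog idfun 1 0 Rh.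
  have /closed_rootP[a] : size (slice_at 1 0 R) != 1%N.
    apply: contraNneq r0 => szR1; rewrite -[X in X == _]cR nth_default //.
    by rewrite [size _]szR1.
  by rewrite rootE horner_slice_at => /eqP; exists a.
pose T := X 1 * R - X 2 * Q.
pose U := X 1 * P - X 0 * Q.
pose L := X 0 - a *: X 1.
pose V := (R.@[triple 1 0 0])^-1 *: (L * R - X 2 * (P - a *: Q)).
have Th : T \is d.+1.-homog by rewrite rpredB ?Mh.
have Vh : V \is d.+1.-homog.
  by rewrite rpredZ // rpredB ?Mh // rpredB // rpredZ.
have V1 : V.@[triple 1 0 0] = 1.
  rewrite mevalZ mevalB !mevalM mevalB mevalZ !XE mulr0 subr0 mul1r mul0r.
  by rewrite subr0 mulVf.
have V0 x y z : V.@[triple x y z] = 0 ->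
    (x - a * y) * R.@[triple x y z]
      = z * (P.@[triple x y z] - a * Q.@[triple x y z]).
  move/eqP; rewrite mevalZ mulf_eq0 invr_eq0 (negPf r0) /= mevalB !mevalM.
  by rewrite !mevalB !mevalZ !XE subr_eq0 => /eqP.
have TE x y z : T.@[triple x y z]
    = y * R.@[triple x y z] - z * Q.@[triple x y z].
  by rewrite mevalB !mevalM !XE.
have UE x y z : U.@[triple x y z]
    = y * P.@[triple x y z] - x * Q.@[triple x y z].
  by rewrite mevalB !mevalM !XE.
have LE x y z : L.@[triple x y z] = x - a * y by rewrite mevalB mevalZ !XE.
have [NT NTE] := norm_poly Vh V1 T 'X 1.
(* A zero of N_T on the chart z = 1 is a solution. *)
have [/closed_rootP[s]|] := boolP (size NT != 1%N).
  rewrite rootE NTE hornerX hornerC => /eqP/(norm_eq0 Vh V1)[x /V0 Vx].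
  rewrite TE mul1r => /eqP; rewrite subr_eq0 => /eqP/esym QE.
  have PE : P.@[triple x s 1] = x * R.@[triple x s 1].
    have -> : P.@[triple x s 1]
        = (x - a * s) * R.@[triple x s 1] + a * Q.@[triple x s 1].
      by rewrite Vx; ring.
    by rewrite QE; ring.
  exists x, s, 1; rewrite oner_eq0 orbT; split=> //.
  - by rewrite PE QE; ring.
  - by rewrite PE mul1r.
  - by rewrite QE mul1r.
rewrite negbK => /size_poly1P[c c0 NTc].
(* Otherwise N_T is constant there, and homogeneity carries this over to the
   chart y = 1. *)
have NT1 s : s != 0 -> norm V T 1 s = c * s ^+ (d.+1 * d.+1).
  move=> s0; have := norm_homog Vh V1 s^-1 1 Th s0.
  have := NTE s^-1; rewrite NTc !hornerC hornerX => <-.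
  by rewrite divff // mulr1 mulrC.
have [NU NUE] := norm_poly Vh V1 U 1 'X.
have [NL NLE] := norm_poly Vh V1 L 1 'X.
(* Multiplicativity of the norm, with (x - a) T = s U on V = 0.  It is enough
   to compare the two polynomials away from s = 0. *)
have NUL : NU = c%:P * 'X^(d.+1 * d) * NL.
  apply: eq_poly_neq0 => s s0.
  rewrite !hornerM !hornerC hornerXn NUE NLE hornerX hornerC.
  apply: (mulfI (expf_neq0 d.+1 s0)); rewrite mulrA.
  rewrite [_ * (c * _)]mulrCA -exprD -mulnS -NT1 //.
  rewrite /norm -{1}(size_fibre Vh V1 1 s) -prodr_scale -big_split /=.
  apply: eq_big_seq => x; rewrite (mem_fibre Vh V1) => /eqP/V0.
  rewrite TE LE UE mulr1 !mul1r => Vx.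
  have -> : s * (P.@[triple x 1 s] - x * Q.@[triple x 1 s])
    = s * (P.@[triple x 1 s] - a * Q.@[triple x 1 s])
      - (x - a) * (s * Q.@[triple x 1 s]).
    by ring.
  by rewrite -Vx; ring.
have : norm V U 1 0 = 0.
  have := NUE 0; rewrite hornerX hornerC => <-.
  by rewrite NUL !hornerM hornerXn expr0n muln_eq0 /= gtn_eqF // mulr0 mul0r.
case/(norm_eq0 Vh V1) => x /V0; rewrite mul0r mulr1 UE => VR Ux.
have Rx : R.@[triple x 1 0] = 0.
  by move/eqP: VR; rewrite mulf_eq0 subr_eq0 => /orP[/eqP->|/eqP].
exists x, 1, 0; rewrite oner_eq0 Rx !mul0r !mulr0; split=> //.
by apply/eqP; rewrite -subr_eq0 Ux.
Qed.

(** * Vector fields modulo the Euler field, over any field *)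

(** The constructions of the statement make sense over any field, and at
    F = R[i] they unfold to it.  Working over an abstract field keeps the
    construction of the complex numbers out of the algebra. *)
Section Definitions.
Variable F : fieldType.

Definition vf : Type := 'cV[{mpoly F[3]}]_3.

Definition homogeneous_vf (d : nat) (X : vf) : Prop :=
  forall i, X i 0 \is d.-homog.

Definition euler : vf := \col_i 'X_i.

Definition eq_mod_euler (d : nat) (X Y : vf) : Prop :=
  exists2 G : {mpoly F[3]}, G \is d.-1.-homog & X - Y = G *: euler.

Definition subst_forms (h : 'M[F]_3) : 3.-tuple {mpoly F[3]} :=
  [tuple \sum_(j < 3) (h i j)%:MP * 'X_j | i < 3].

Definition push (g : 'M[F]_3) (X : vf) : vf :=
  map_mx (@mpolyC 3 F) g
    *m map_mx (fun p => p \mPo subst_forms (invmx g)) X.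

Definition vf_at (X : vf) (p : 'cV[F]_3) : 'cV[F]_3 :=
  map_mx (meval (fun j => p j 0)) X.

Definition singular_at (X : vf) (p : 'cV[F]_3) : Prop :=
  p != 0 /\ exists a : F, vf_at X p = a *: p.

Definition basis_mod_euler (d N : nat) (nu : 'I_N -> vf) : Prop :=
  [/\ forall i, homogeneous_vf d (nu i),
      forall X, homogeneous_vf d X ->
        exists a : 'I_N -> F, eq_mod_euler d X (\sum_i (a i)%:MP *: nu i)
    & forall a : 'I_N -> F,
        eq_mod_euler d (\sum_i (a i)%:MP *: nu i) 0 -> forall i, a i = 0].

Definition restrict_x1 (h : {mpoly F[3]}) : {mpoly F[2]} :=
  h \mPo [tuple 1; 'X_0; 'X_1].

Definition local_f (X : vf) : {mpoly F[2]} :=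
  restrict_x1 (X 1 0) - 'X_0 * restrict_x1 (X 0 0).

Definition local_g (X : vf) : {mpoly F[2]} :=
  restrict_x1 (X 2 0) - 'X_1 * restrict_x1 (X 0 0).

Definition vanishing_order (h : {mpoly F[2]}) : option nat :=
  if h == 0 then None
  else Some (\big[minn/msize h]_(k <- msupp h) mdeg k).

End Definitions.

Section Action.
Variable F : fieldType.
Implicit Types (g h : 'M[F]_3) (X Y : vf F) (p : {mpoly F[3]}).

Lemma tnth_subst_forms h i :
  tnth (subst_forms h) i = \sum_(j < 3) (h i j)%:MP * 'X_j.
Proof. by rewrite tnth_mktuple. Qed.

Lemma comp_mpoly_tuple n k l (p0 : {mpoly F[n]}) (lp : n.-tuple {mpoly F[k]})
    (lq : k.-tuple {mpoly F[l]}) :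
  (p0 \mPo lp) \mPo lq = p0 \mPo [tuple tnth lp i \mPo lq | i < n].
Proof.
rewrite [p0 \mPo lp]comp_mpolyEX [RHS]comp_mpolyEX rmorph_sum.
apply: eq_bigr => m _; rewrite /= comp_mpolyZ !comp_mpolyX rmorph_prod.
by congr (_ *: _); apply: eq_bigr => i _; rewrite rmorphXn tnth_mktuple.
Qed.

Lemma comp_subst_forms h g p :
  (p \mPo subst_forms h) \mPo subst_forms g = p \mPo subst_forms (h *m g).
Proof.
rewrite comp_mpoly_tuple; apply: (congr1 (fun l => comp_mpoly l p)).
apply: eq_from_tnth => i.
rewrite tnth_mktuple !tnth_subst_forms rmorph_sum /=.
under eq_bigr => j _ do rewrite rmorphM /= comp_mpolyC comp_mpolyXU -tnth_nth
  tnth_subst_forms mulr_sumr.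
rewrite exchange_big; apply: eq_bigr => j _ /=.
rewrite mxE rmorph_sum mulr_suml; apply: eq_bigr => k _.
by rewrite rmorphM mulrA.
Qed.

Lemma comp_subst_forms1 p : p \mPo subst_forms 1%:M = p.
Proof.
rewrite -[RHS]comp_mpoly_id; apply: (congr1 (fun l => comp_mpoly l p)).
apply: eq_from_tnth => i.
rewrite tnth_subst_forms tnth_mktuple (bigD1 i) //= big1 => [|j ji].
  by rewrite mxE eqxx mul1r addr0.
by rewrite mxE eq_sym (negPf ji) mul0r.
Qed.

Lemma comp_subst_forms_homog d h p :
  p \is d.-homog -> p \mPo subst_forms h \is d.-homog.
Proof.
move=> /dhomogP pd; rewrite comp_mpolyEX big_seq rpred_sum // => m /pd /= <-.
rewrite rpredZ // comp_mpolyX mdegE.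
elim/big_rec2: _ => [|i k q _ qk]; first exact: dhomog1.
have li : tnth (subst_forms h) i \is 1.-homog.
  rewrite tnth_subst_forms rpred_sum // => j _.
  by rewrite mul_mpolyC rpredZ // dhomogX /= mdeg1.
by apply: dhomogM qk; have := dhomogMn (m i) li; rewrite mul1n.
Qed.

Lemma pushE g X i j : push g X i j
  = \sum_k (g i k)%:MP * (X k j \mPo subst_forms (invmx g)).
Proof. by rewrite mxE; apply: eq_bigr => k _; rewrite !mxE. Qed.

Lemma pushD g X Y : push g (X + Y) = push g X + push g Y.
Proof.
apply/matrixP=> i j; rewrite [LHS]pushE [RHS]mxE.
rewrite [X in _ = X + _]pushE [X in _ = _ + X]pushE -big_split.
by apply: eq_bigr => k _; rewrite [X in X \mPo _]mxE rmorphD mulrDr.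
Qed.

Lemma pushZ g p X : push g (p *: X)
  = (p \mPo subst_forms (invmx g)) *: push g X.
Proof.
apply/matrixP=> i j; rewrite [LHS]pushE [RHS]mxE.
rewrite [X in _ = _ * X]pushE mulr_sumr.
by apply: eq_bigr => k _; rewrite [X in X \mPo _]mxE rmorphM mulrCA.
Qed.

Lemma pushZC g c X : push g (c%:MP *: X) = c%:MP *: push g X.
Proof. by rewrite pushZ comp_mpolyC. Qed.

Lemma push0 g : push g 0 = 0.
Proof.
by have := pushZ g 0 0; rewrite scale0r => ->; rewrite rmorph0 scale0r.
Qed.

Lemma pushB g X Y : push g (X - Y) = push g X - push g Y.
Proof.
have := pushZ g (-1) Y; rewrite rmorphN rmorph1 !scaleN1r => gN.
by rewrite pushD gN.
Qed.

Lemma push_sum g (I : Type) (r : seq I) (P : pred I) (H : I -> vf F) :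
  push g (\sum_(i <- r | P i) H i) = \sum_(i <- r | P i) push g (H i).
Proof. exact: (big_morph _ (pushD g) (push0 g)). Qed.

Lemma push_comp g h X : g \in unitmx -> h \in unitmx ->
  push g (push h X) = push (g *m h) X.
Proof.
move=> gU hU; have E : invmx (g *m h) = invmx h *m invmx g.
  exact: (@invrM 'M[F]_3).
apply/matrixP=> i j; rewrite [LHS]pushE [RHS]pushE E.
transitivity (\sum_(k < 3) \sum_(l < 3) (g i k)%:MP * ((h k l)%:MP *
    (X l j \mPo subst_forms (invmx h *m invmx g)))).
  apply: eq_bigr => k _; rewrite [Y in Y \mPo _]pushE rmorph_sum mulr_sumr.
  apply: eq_bigr => l _.
  by rewrite rmorphM /= comp_mpolyC comp_subst_forms.
rewrite exchange_big; apply: eq_bigr => l _ /=.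
rewrite [Y in _ = Y%:MP * _]mxE rmorph_sum mulr_suml; apply: eq_bigr => k _.
by rewrite rmorphM mulrA.
Qed.

Lemma push1 X : push 1%:M X = X.
Proof.
apply/matrixP=> i j; rewrite pushE invmx1 (bigD1 i) //= big1 => [|k ki].
  by rewrite mxE eqxx mul1r addr0 comp_subst_forms1.
by rewrite mxE eq_sym (negPf ki) mul0r.
Qed.

Lemma push_euler g : g \in unitmx -> push g (euler F) = euler F.
Proof.
move=> gU; apply/matrixP=> i j; rewrite pushE [RHS]mxE.
rewrite -[RHS]comp_subst_forms1 -(mulmxV gU) comp_mpolyXU -tnth_nth.
rewrite tnth_subst_forms.
transitivity (\sum_(k < 3) \sum_(l < 3) 
    (g i k)%:MP * ((invmx g k l)%:MP * 'X_l)).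
  apply: eq_bigr => k _; rewrite [Y in Y \mPo _]mxE comp_mpolyXU -tnth_nth.
  by rewrite tnth_subst_forms mulr_sumr.
rewrite exchange_big; apply: eq_bigr => l _ /=.
rewrite [Y in _ = Y%:MP * _]mxE rmorph_sum mulr_suml; apply: eq_bigr => k _.
by rewrite rmorphM mulrA.
Qed.

Lemma push_homog d g X : homogeneous_vf d X -> homogeneous_vf d (push g X).
Proof.
move=> Xd i; rewrite pushE rpred_sum // => j _.
by rewrite mul_mpolyC rpredZ // comp_subst_forms_homog.
Qed.

Lemma vf_at_push g X (p : 'cV[F]_3) :
  vf_at (push g X) p = g *m vf_at X (invmx g *m p).
Proof.
apply/matrixP=> i j; rewrite [LHS]mxE ord1 pushE raddf_sum [RHS]mxE.
apply: eq_bigr => k _ /=; rewrite [Y in _ = _ * Y]mxE mevalM mevalC.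
rewrite comp_mpoly_meval.
apply: (congr1 (fun c => g i k * c)).
apply: meval_eq => l; rewrite tnth_subst_forms raddf_sum [RHS]mxE.
by apply: eq_bigr => m _ /=; rewrite mevalM mevalC mevalXU.
Qed.

Lemma singular_push g X (p : 'cV[F]_3) : g \in unitmx ->
  singular_at X p -> singular_at (push g X) (g *m p).
Proof.
move=> gU [p0 [a Xp]]; split; last first.
  by exists a; rewrite vf_at_push mulKmx // Xp scalemxAr.
by apply: contraNneq p0 => gp; rewrite -(mulKmx gU p) gp mulmx0.
Qed.

Variable d : nat.

Lemma eq_mod_euler_refl X : eq_mod_euler d X X.
Proof. by exists 0; rewrite ?dhomog0 // subrr scale0r. Qed.

Lemma eq_mod_eulerZ c X Y :
  eq_mod_euler d X Y -> eq_mod_euler d (c%:MP *: X) (c%:MP *: Y).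
Proof.
case=> G Gh XY; exists (c%:MP * G); first by rewrite mul_mpolyC rpredZ.
by rewrite -scalerBr XY scalerA.
Qed.

Lemma eq_mod_eulerD X Y X' Y' : eq_mod_euler d X Y ->
  eq_mod_euler d X' Y' -> eq_mod_euler d (X + X') (Y + Y').
Proof.
case=> G Gh XY [G' Gh' XY']; exists (G + G'); first by rewrite rpredD.
by rewrite opprD addrACA XY XY' scalerDl.
Qed.

Lemma eq_mod_euler_sym X Y : eq_mod_euler d X Y -> eq_mod_euler d Y X.
Proof.
by case=> G Gh XY; exists (- G); rewrite ?rpredN // scaleNr -XY opprB.
Qed.

Lemma eq_mod_euler_trans X Y Z :
  eq_mod_euler d X Y -> eq_mod_euler d Y Z -> eq_mod_euler d X Z.
Proof.
case=> G Gh XY [G' Gh' YZ]; exists (G + G'); first by rewrite rpredD.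
by rewrite scalerDl -XY -YZ addrA subrK.
Qed.

Lemma eq_mod_euler_sum (I : Type) (r : seq I) (H G : I -> vf F) :
  (forall i, eq_mod_euler d (H i) (G i)) ->
  eq_mod_euler d (\sum_(i <- r) H i) (\sum_(i <- r) G i).
Proof.
move=> HG; elim/big_rec2: _ => *.
  exact: eq_mod_euler_refl.
by apply: eq_mod_eulerD.
Qed.

Lemma eq_mod_euler_push g X Y : g \in unitmx ->
  eq_mod_euler d X Y -> eq_mod_euler d (push g X) (push g Y).
Proof.
move=> gU [G Gh XY]; exists (G \mPo subst_forms (invmx g)).
  exact: comp_subst_forms_homog.
by rewrite -pushB XY pushZ push_euler.
Qed.

End Action.

(** * Existence of singular points *)

Lemma ord3_neq0 (i : 'I_3) : i != 0 -> i = 1 \/ i = 2.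
Proof. by case: i => -[|[|[|]]] // *; [left | right]; apply/val_inj. Qed.

Section Existence.
Variable F : numClosedFieldType.
Implicit Types (X : vf F).

Lemma vf_at_triple X (x y z : F) i :
  vf_at X (\col_j triple x y z j) i 0 = (X i 0).@[triple x y z].
Proof. by rewrite mxE; apply: meval_eq => j; rewrite mxE. Qed.

Lemma exists_singular_of_transverse d X : (0 < d)%N -> homogeneous_vf d X ->
  (X 2 0).@[triple 1 0 0] != 0 -> exists p, singular_at X p.
Proof.
move=> d0 Xd R0.
have [x [y [z [yz PQ PR QR]]]] := exists_parallel d0 (Xd 0) (Xd 1) (Xd 2) R0.
pose p : 'cV[F]_3 := \col_j triple x y z j.
have pE : (p 0 0 = x) * (p 1 0 = y) * (p 2 0 = z) by rewrite !mxE.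
have p0 : p != 0.
  apply: contraTneq yz => p0; rewrite -[y]pE -[z]pE p0 !mxE eqxx.
  by [].
exists p; split=> //.
have [y0|y0] := eqVneq y 0.
  have z0 : z != 0 by move: yz; rewrite y0 eqxx.
  exists ((X 2 0).@[triple x y z] / z); apply/colP => i.
  rewrite vf_at_triple [RHS]mxE; apply: (mulfI z0).
  rewrite mulrA [z * (_ / z)]mulrC divfK //.
  have [->|/ord3_neq0[]->] := eqVneq i 0; rewrite pE.
  - by rewrite PR mulrC.
  - by rewrite QR mulrC.
  - by rewrite mulrC.
exists ((X 1 0).@[triple x y z] / y); apply/colP => i.
rewrite vf_at_triple [RHS]mxE; apply: (mulfI y0).
rewrite mulrA [y * (_ / y)]mulrC divfK //.
have [->|/ord3_neq0[]->] := eqVneq i 0; rewrite pE.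
- by rewrite PQ mulrC.
- by rewrite mulrC.
- by rewrite -QR mulrC.
Qed.

(** If [1:0:0] is not singular then Q or R does not vanish there; exchanging
    y and z if necessary, R does not. *)
Lemma exists_singular d X : (0 < d)%N -> homogeneous_vf d X ->
  exists p, singular_at X p.
Proof.
move=> d0 Xd.
have [R0|R0] := eqVneq (X 2 0).@[triple 1 0 0] 0; last first.
  exact: (exists_singular_of_transverse d0 Xd R0).
have [Q0|Q0] := eqVneq (X 1 0).@[triple 1 0 0] 0.
  exists (\col_j triple 1 0 0 j); split.
    by apply/eqP => /colP/(_ 0); rewrite !mxE => /eqP; rewrite oner_eq0.
  exists ((X 0 0).@[triple 1 0 0]); apply/colP => i; rewrite vf_at_triple !mxE.
  have [->|/ord3_neq0[]->] := eqVneq i 0; first by rewrite /triple /= mulr1.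
    by rewrite Q0 /triple /= mulr0.
  by rewrite R0 /triple /= mulr0.
pose s : 'M[F]_3 := tperm_mx 1 2.
have sU : s \in unitmx by apply: unitmx_perm.
have ss : s *m s = 1%:M by rewrite -perm_mxM tperm2 perm_mx1.
have sV : invmx s = s by rewrite -[LHS]mulmx1 -ss mulmxA mulVmx // mul1mx.
have [|q Sq] := exists_singular_of_transverse d0 (push_homog s Xd).
  rewrite -vf_at_triple vf_at_push sV.
  have -> : s *m (\col_j triple 1 0 0 j) = \col_j triple 1 0 0 j :> 'cV[F]_3.
    rewrite -row_permE; apply/colP => i; rewrite !mxE permE /=.
    by have [->|/ord3_neq0[]->] := eqVneq i 0.
  rewrite -row_permE mxE tpermR vf_at_triple; exact: Q0.
exists (s *m q); rewrite -[X]push1 -ss -push_comp //.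
exact: singular_push.
Qed.
End Existence.

(** * Nonnegative weights *)

Lemma exprz2_inj (F : numFieldType) : injective (fun k : int => (2 : F) ^ k).
Proof.
move=> k l /= kl; apply/eqP; rewrite -subr_eq0.
have : (2 : F) ^ (k - l) == 1.
  rewrite expfzDr ?pnatr_eq0 // kl -expfzDr ?pnatr_eq0 //.
  by rewrite subrr expr0z.
by rewrite pexprz_eq1 ?ler0n // pnatr_eq1 orbF.
Qed.

Section Mumford.
Variables (F : numFieldType) (d N : nat) (nu : 'I_N -> vf F).
Variables (r : 'I_N -> int) (g : 'M[F]_3).
Hypotheses (nu_basis : basis_mod_euler d nu) (gU : g \in unitmx).
Hypothesis nu_eigen : forall i,
  eq_mod_euler d (push g (nu i)) ((2 ^ r i)%:MP *: nu i).

Lemma homogD (X Y : vf F) :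
  homogeneous_vf d X -> homogeneous_vf d Y -> homogeneous_vf d (X + Y).
Proof. by move=> Xd Yd i; rewrite mxE rpredD. Qed.

(** Stated through all expansions of X on nu, rather than through a chosen
    one, so that it applies directly to the expansion that computes a Mumford
    function. *)
Definition nonneg_weights (X : vf F) : Prop :=
  homogeneous_vf d X /\ forall a : 'I_N -> F,
    eq_mod_euler d X (\sum_i (a i)%:MP *: nu i) ->
    forall i, a i != 0 -> 0 <= r i.

Lemma coordsB (X Y : vf F) (a b : 'I_N -> F) :
  eq_mod_euler d X (\sum_i (a i)%:MP *: nu i) ->
  eq_mod_euler d Y (\sum_i (b i)%:MP *: nu i) ->
  eq_mod_euler d (X - Y) (\sum_i (a i - b i)%:MP *: nu i).
Proof.
move=> Xa /(eq_mod_eulerZ (-1)) Yb; have := eq_mod_eulerD Xa Yb.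
rewrite rmorphN rmorph1 !scaleN1r => E.
by under eq_bigr do rewrite rmorphB scalerBl; rewrite sumrB.
Qed.

Lemma coords_inj (X : vf F) (a b : 'I_N -> F) :
  eq_mod_euler d X (\sum_i (a i)%:MP *: nu i) ->
  eq_mod_euler d X (\sum_i (b i)%:MP *: nu i) ->
  a =1 b.
Proof.
move=> Xa Xb i; have [_ _ free] := nu_basis.
apply/eqP; rewrite -subr_eq0; apply/eqP; apply: (free (fun i => a i - b i)).
by have := coordsB Xa Xb; rewrite subrr; apply: eq_mod_euler_sym.
Qed.

Lemma nonneg_weights0 : nonneg_weights 0.
Proof.
split=> [i|a a0 i]; first by rewrite mxE dhomog0.
have [_ _ free] := nu_basis.
by rewrite (free _ (eq_mod_euler_sym a0)) eqxx.
Qed.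

Lemma nonneg_weightsD X Y :
  nonneg_weights X -> nonneg_weights Y -> nonneg_weights (X + Y).
Proof.
move=> [Xd wX] [Yd wY]; split=> [|a aXY i ai]; first exact: homogD.
have [_ gen _] := nu_basis; have [b bX] := gen X Xd.
have [bi0|/(wX b bX)//] := eqVneq (b i) 0.
apply: (wY (fun i => a i - b i)); last by rewrite bi0 subr0.
by have := coordsB aXY bX; rewrite addrAC subrr add0r.
Qed.

(** Eigenvectors with distinct eigenvalues of g are independent, and distinct
    integer weights give distinct powers of 2: a single element of the
    one-parameter subgroup is enough to separate weights. *)
Lemma nonneg_weights_eigen (w : int) X : 0 <= w -> homogeneous_vf d X ->
  push g X = (2 ^ w)%:MP *: X -> nonneg_weights X.
Proof.
move=> w0 Xd gX; split=> // a aX i ai.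
suff -> : r i = w by [].
have E1 : eq_mod_euler d (push g X) (\sum_i (2 ^ w * a i)%:MP *: nu i).
  under eq_bigr do rewrite rmorphM -scalerA; rewrite -scaler_sumr gX.
  exact: eq_mod_eulerZ.
have E2 : eq_mod_euler d (push g X) (\sum_i (a i * 2 ^ r i)%:MP *: nu i).
  apply: eq_mod_euler_trans (eq_mod_euler_push gU aX) _; rewrite push_sum.
  apply: eq_mod_euler_sum => j.
  by rewrite pushZC rmorphM -scalerA; apply: eq_mod_eulerZ.
have /eqP := coords_inj E1 E2 i; rewrite mulrC (inj_eq (mulfI ai)) => /eqP.
by move/exprz2_inj.
Qed.

End Mumford.

(** * The chart at [1:0:0] *)

Section Chart.
Variable F : fieldType.
Implicit Types (h : {mpoly F[3]}) (X Y : vf F) (m : 'X_{1..3}).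

Definition local_mnm m : 'X_{1..2} := [multinom m (lift ord0 i) | i < 2].

Lemma mdeg_local_mnm m : mdeg m = (m ord0 + mdeg (local_mnm m))%N.
Proof.
by rewrite !mdegE big_ord_recl; under [in RHS]eq_bigr do rewrite mnmE.
Qed.

(** Dehomogenising loses no monomial: the exponent of x is determined by the
    degree. *)
Lemma local_mnm_inj m m' :
  mdeg m = mdeg m' -> local_mnm m = local_mnm m' -> m = m'.
Proof.
move=> dm lm; apply/mnmP => i; case: (unliftP ord0 i) => [j|] ->.
  by move/mnmP/(_ j): lm; rewrite !mnmE.
by move: dm; rewrite !mdeg_local_mnm lm => /addIn.
Qed.

Lemma restrict_x1E h :
  restrict_x1 h = \sum_(m <- msupp h) h@_m *: 'X_[local_mnm m].
Proof.
rewrite /restrict_x1 comp_mpolyEX; apply: eq_bigr => m _; congr (_ *: _).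
rewrite comp_mpolyX [RHS]mpolyXE_id big_ord_recl (tnth_nth 0) /= expr1n mul1r.
apply: eq_bigr => i _; rewrite mnmE (tnth_nth 0).
by case: i => -[|[|]] //= i; congr ('X_[U_(_)] ^+ _); apply/val_inj.
Qed.

Lemma coef_restrict_x1 d h m : h \is d.-homog -> mdeg m = d ->
  (restrict_x1 h)@_(local_mnm m) = h@_m.
Proof.
move=> /dhomogP hd md; rewrite restrict_x1E raddf_sum /= big_seq.
rewrite (eq_bigr (fun m' => h@_m' * ('X_[m'] : {mpoly F[3]})@_m)).
  rewrite -big_seq [in RHS](mpolyE h) raddf_sum.
  by apply: eq_bigr => k _; rewrite /= mcoeffZ.
move=> m' /hd md'; rewrite mcoeffZ !mcoeffX; congr (_ * (nat_of_bool _)%:R).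
by apply/eqP/eqP => [|-> //]; apply: local_mnm_inj; rewrite md' md.
Qed.

Lemma restrict_x1B h h' : restrict_x1 (h - h') = restrict_x1 h - restrict_x1 h'.
Proof. exact: rmorphB. Qed.

Lemma restrict_x1M h h' : restrict_x1 (h * h') = restrict_x1 h * restrict_x1 h'.
Proof. exact: rmorphM. Qed.

Lemma local_euler X (G : {mpoly F[3]}) :
  local_f (X - G *: euler F) = local_f X
  /\ local_g (X - G *: euler F) = local_g X.
Proof.
rewrite /local_f /local_g !mxE !restrict_x1B !restrict_x1M.
have -> : restrict_x1 'X_0 = 1 :> {mpoly F[2]} by rewrite [LHS]comp_mpolyXU.
have -> : restrict_x1 'X_1 = 'X_0 :> {mpoly F[2]} by rewrite [LHS]comp_mpolyXU.
have -> : restrict_x1 'X_2 = 'X_1 :> {mpoly F[2]} by rewrite [LHS]comp_mpolyXU.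
by split; rewrite mulr1 [restrict_x1 G * _]mulrC mulrBr opprB addrA subrK.
Qed.

(** A normal form modulo the Euler field: no monomial of P is divisible by x. *)
Definition reduced X : Prop := forall m, (X 0 0)@_m != 0 -> m ord0 = 0%N.

(** Write P = xG + P' with P' free of x, and subtract G times the Euler field;
    this does not change the local equations. *)
Lemma exists_reduced d X : homogeneous_vf d X ->
  exists Y, [/\ homogeneous_vf d Y, reduced Y, eq_mod_euler d X Y,
                local_f Y = local_f X & local_g Y = local_g X].
Proof.
move=> Xd; pose P := X 0 0.
have Pd m : m \in msupp P -> mdeg m = d by apply: (dhomog_mf (Xd 0)).
pose G := \sum_(m <- msupp P | m ord0 != 0%N) P@_m *: 'X_[m - U_(ord0)].
have Gd : G \is d.-1.-homog.
  rewrite /G big_seq_cond rpred_sum // => m /andP[/Pd md m0].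
  rewrite rpredZ // dhomogX /= -md; apply/eqP.
  have le : (U_(ord0) <= m)%MM by rewrite lep1mP.
  by rewrite -[in RHS](submK le) mdegD mdeg1 addn1.
have GX : G * 'X_ord0 = \sum_(m <- msupp P | m ord0 != 0%N) P@_m *: 'X_[m].
  rewrite mulr_suml; apply: eq_bigr => m m0.
  by rewrite -scalerAl -mpolyXD submK // lep1mP.
have radd : homogeneous_vf d (G *: euler F).
  case: (posnP d) => [d0 i|d0 i].
    rewrite !mxE /G big_seq_cond big1 ?mul0r ?dhomog0 // => m /andP[/Pd md].
    by have := mdeg_local_mnm m; rewrite md d0; case: (m ord0).
  have Xi : ('X_i : {mpoly F[3]}) \is 1.-homog by rewrite dhomogX /= mdeg1.
  by rewrite !mxE; have := dhomogM Gd Xi; rewrite addn1 prednK.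
have subE i : (X - G *: euler F) i 0 = X i 0 - (G *: euler F) i 0.
  by rewrite [LHS]mxE [Y in _ + Y]mxE.
exists (X - G *: euler F); have [-> ->] := local_euler X G; split=> //.
- by move=> i; rewrite subE rpredB.
- move=> m; apply: contraNeq => m0.
  rewrite subE [Y in _ - Y]mxE [Y in _ * Y]mxE -/P GX.
  rewrite {1}(mpolyE P) (bigID (fun m => m ord0 != 0%N)) /= addrAC subrr add0r.
  rewrite raddf_sum big1 //= => k; rewrite negbK => k0.
  rewrite mcoeffZ mcoeffX; case: eqP => [km|]; last by rewrite mulr0.
  by rewrite -km (eqP k0) in m0.
- by exists G => //; rewrite opprB addrC subrK.
Qed.

(** For a reduced field y P(1,y,z) and z P(1,y,z) are homogeneous of degree
    d + 1, so they cannot cancel monomials of Q(1,y,z) and R(1,y,z), which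
    have degree at most d. *)
Lemma coef_local_reduced d X : homogeneous_vf d X -> reduced X ->
  forall m, mdeg m = d ->
    (local_f X)@_(local_mnm m) = (X 1 0)@_m
    /\ (local_g X)@_(local_mnm m) = (X 2 0)@_m.
Proof.
move=> Xd Xr m md.
have Ph : restrict_x1 (X 0 0) \is d.-homog.
  rewrite restrict_x1E big_seq rpred_sum // => k kP.
  rewrite rpredZ // dhomogX /= -(dhomog_mf (Xd 0) kP) /=.
  by rewrite mdeg_local_mnm Xr -?mcoeff_msupp.
have P0 i : ('X_i * restrict_x1 (X 0 0))@_(local_mnm m) = 0.
  have XPh : 'X_i * restrict_x1 (X 0 0) \is d.+1.-homog.
    have Xh : ('X_i : {mpoly F[2]}) \is 1.-homog by rewrite dhomogX /= mdeg1.
    exact: dhomogM Xh Ph.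
  apply: (dhomog_nemf_coeff XPh) => /=.
  by rewrite -md mdeg_local_mnm neq_ltn ltnS leq_addl.
by rewrite !mcoeffB !P0 !subr0 !(coef_restrict_x1 (Xd _) md).
Qed.

(** Reducing X, the terms of degree at most d give Q = R = 0, and then the
    term of degree d + 1 gives P = 0. *)
Lemma local_eq0 d X : homogeneous_vf d X ->
  local_f X = 0 -> local_g X = 0 -> eq_mod_euler d X 0.
Proof.
move=> Xd f0 g0; have [Y [Yd Yr XY Yf Yg]] := exists_reduced Xd.
rewrite -Yf in f0; rewrite -Yg in g0.
have Y0 (i : 'I_3) : i != 0 -> Y i 0 = 0.
  move=> i0; apply/mpolyP => m; rewrite mcoeff0.
  have [md|md] := eqVneq (mdeg m) d; last exact: dhomog_nemf_coeff (Yd i) md.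
  have [] := coef_local_reduced Yd Yr md; rewrite f0 g0 !mcoeff0 => E1 E2.
  by case: (ord3_neq0 i0) => ->; apply: esym.
suff Y00 : Y 0 0 = 0.
  suff Y00' : Y = 0 by rewrite -[X in eq_mod_euler _ _ X]Y00'.
  apply/matrixP => i j; rewrite ord1 [RHS]mxE.
  by have [->|/Y0] := eqVneq i 0.
have : 'X_0 * restrict_x1 (Y 0 0) = 0.
  have E : restrict_x1 (Y 1 0) = 0.
    by rewrite (Y0 1 isT) /restrict_x1 comp_mpoly0.
  by move: f0; rewrite /local_f E sub0r => /eqP; rewrite oppr_eq0 => /eqP.
move/eqP; rewrite mulf_eq0 -[_ == 0]msupp_eq0 msuppX /= => /eqP P0.
apply/mpolyP => m; rewrite mcoeff0.
have [md|md] := eqVneq (mdeg m) d; last exact: dhomog_nemf_coeff (Yd 0) md.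
by rewrite -(coef_restrict_x1 (Yd 0) md) P0 mcoeff0.
Qed.

Lemma vanishing_order_le (p : {mpoly F[2]}) k : p@_k != 0 ->
  exists2 n, vanishing_order p = Some n & (n <= mdeg k)%N.
Proof.
rewrite -mcoeff_msupp /vanishing_order => kp; case: eqP => [p0|_].
  by rewrite p0 msupp0 in kp.
eexists; first reflexivity.
elim: (msupp p : seq _) kp => // a s IHs; rewrite inE big_cons geq_min.
by case/orP => [/eqP->|/IHs ->]; rewrite ?leqnn ?orbT.
Qed.

Lemma multiplicity_le d X n : homogeneous_vf d X -> reduced X ->
  omin (vanishing_order (local_f X)) (vanishing_order (local_g X)) = Some n ->
  forall (i : 'I_3) m, i != 0 -> m \in msupp (X i 0) -> (n + m ord0 <= d)%N.
Proof.
move=> Xd Xr on i m i0; have [md|md] := eqVneq (mdeg m) d; last first.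
  by rewrite mcoeff_msupp (dhomog_nemf_coeff (Xd i) md) eqxx.
rewrite mcoeff_msupp => Xm; rewrite -md mdeg_local_mnm addnC leq_add2l.
have [Ef Eg] := coef_local_reduced Xd Xr md.
case: (ord3_neq0 i0) Xm => ->.
  rewrite -Ef => /vanishing_order_le[k fk km]; apply: leq_trans km.
  move: on; rewrite fk.
  by case: vanishing_order => [k'|] /= [<-]; rewrite ?geq_minl.
rewrite -Eg => /vanishing_order_le[k gk km]; apply: leq_trans km.
move: on; rewrite gk.
by case: vanishing_order => [k'|] /= [<-]; rewrite ?geq_minr.
Qed.
End Chart.

(** * The destabilising one-parameter subgroup *)

Section Weights.
Variable F : numFieldType.
Implicit Types (X : vf F) (m : 'X_{1..3}).

Lemma comp_diag (w : 'rV[F]_3) m :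
  'X_[m] \mPo subst_forms (diag_mx w) = (\prod_j w 0 j ^+ m j)%:MP * 'X_[m].
Proof.
rewrite comp_mpolyX [in RHS]mpolyXE_id rmorph_prod -big_split.
apply: eq_bigr => j _ /=; rewrite rmorphXn -exprMn tnth_subst_forms.
congr (_ ^+ _); rewrite (bigD1 j) //= big1 => [|k kj].
  by rewrite mxE eqxx mulr1n addr0.
by rewrite mxE eq_sym (negPf kj) mulr0n mul0r.
Qed.

Lemma invmx_diag (v : 'rV[F]_3) : (forall j, v 0 j != 0) ->
  diag_mx v \in unitmx /\ invmx (diag_mx v) = diag_mx (\row_j (v 0 j)^-1).
Proof.
move=> v0; have vV : diag_mx v *m diag_mx (\row_j (v 0 j)^-1) = 1%:M.
  rewrite mulmx_diag -diag_const_mx; congr diag_mx.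
  by apply/rowP => j; rewrite !mxE divff.
have [vU _] := mulmx1_unit vV; split=> //.
by rewrite -[LHS]mulmx1 -vV mulmxA mulVmx // mul1mx.
Qed.

Lemma push_diag_delta (v : 'rV[F]_3) i :
  push (diag_mx v) (delta_mx i 0) = (v 0 i)%:MP *: delta_mx i 0.
Proof.
apply/colP => k; rewrite pushE (bigD1 i) //= big1 => [|l li].
  rewrite [Y in Y \mPo _]mxE !eqxx rmorph1 mulr1 addr0 [RHS]mxE.
  rewrite [Y in _ = _ * Y]mxE eqxx andbT mxE.
  by case: (eqVneq k i) => [->|]; rewrite ?mulr1n ?mulr1 // mulr0n mulr0.
by rewrite [Y in Y \mPo _]mxE (negPf li) rmorph0 mulr0.
Qed.

Lemma push_diag_monomial (v : 'rV[F]_3) c m i : (forall j, v 0 j != 0) ->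
  push (diag_mx v) ((c *: 'X_[m]) *: delta_mx i 0)
  = (v 0 i * \prod_j (v 0 j)^-1 ^+ m j)%:MP *: ((c *: 'X_[m]) *: delta_mx i 0).
Proof.
move=> v0; have [_ vV] := invmx_diag v0.
rewrite pushZ vV comp_mpolyZ comp_diag push_diag_delta !scalerA; congr (_ *: _).
under eq_bigr do rewrite mxE.
by rewrite -!mul_mpolyC rmorphM; ring.
Qed.

(** The exponents of diag(t^2, t^-1, t^-1). *)
Definition e_wt (j : 'I_3) : int := if j == 0 then 2 else -1.

(** The weight of the monomial field x^m d/dx_i: the differential contributes
    the i-th exponent, the substitution of the inverse the negative of the
    exponents of the variables. *)
Definition weight (i : 'I_3) m : int := e_wt i - \sum_j e_wt j * (m j)%:Z.

Lemma weightE i m : weight i m = e_wt i + (mdeg m)%:Z - 3 * (m ord0)%:Z.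
Proof.
rewrite /weight (mdeg_local_mnm m) mdegE.
rewrite !big_ord_recl !big_ord0 !mnmE /e_wt /=; lia.
Qed.

Definition wt_diag (t : F) : 'M[F]_3 := diag_mx (\row_j t ^ e_wt j).

Lemma push_wt_monomial (t : F) c m i : t != 0 ->
  push (wt_diag t) ((c *: 'X_[m]) *: delta_mx i 0)
  = (t ^ weight i m)%:MP *: ((c *: 'X_[m]) *: delta_mx i 0).
Proof.
move=> t0; rewrite push_diag_monomial => [|j]; last by rewrite mxE expfz_neq0.
apply: (congr1 (fun b : F => b%:MP *: _)).
rewrite mxE /weight expfzDr //; apply: (congr1 (fun b => t ^ e_wt i * b)).
rewrite -sumrN.
rewrite (big_morph (fun k : int => t ^ k)
  (fun k l => expfzDr k l t0) (expr0z t)).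
apply: eq_bigr => j _; by rewrite mxE exprnP exprz_inv exprz_exp mulrN.
Qed.


Lemma vf_monomials X : X = \sum_i \sum_(m <- msupp (X i 0))
  ((X i 0)@_m *: 'X_[m]) *: delta_mx i 0.
Proof.
rewrite {1}(matrix_sum_delta X); apply: eq_bigr => i _.
by rewrite big_ord1 {1}(mpolyE (X i 0)) scaler_suml.
Qed.
(** For a field of multiplicity n, a monomial of Q or R has exponent at most
    d - n in x, hence weight at least 3n - (2d + 1). *)
Lemma weight_ge0 d X n : homogeneous_vf d X -> reduced X ->
  omin (vanishing_order (local_f X)) (vanishing_order (local_g X)) = Some n ->
  (2 * d + 1 <= 3 * n)%N ->
  forall i m, m \in msupp (X i 0) -> 0 <= weight i m.
Proof.
move=> Xd Xr Xn dn i m mX; rewrite weightE.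
have -> : mdeg m = d by apply: (dhomog_mf (Xd i) mX).
have [i0|i0] := eqVneq i 0.
  rewrite i0 in mX *; rewrite (Xr m) -?mcoeff_msupp // /e_wt eqxx; lia.
have := multiplicity_le Xd Xr Xn i0 mX; rewrite /e_wt (negPf i0); lia.
Qed.

End Weights.

Section Destabilise.
Variables (F : numFieldType) (d N : nat) (nu : 'I_N -> vf F).
Variables (r : 'I_N -> int) (g : 'M[F]_3).
Hypotheses (nu_basis : basis_mod_euler d nu) (gU : g \in unitmx).
Hypothesis nu_eigen : forall i, eq_mod_euler d
  (push (g *m wt_diag 2 *m invmx g) (nu i)) ((2 ^ r i)%:MP *: nu i).

(** The monomials of X, moved by g, are eigenvectors of the conjugate of the
    diagonal subgroup, and nonneg_weights is stable under sums. *)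
Lemma nonneg_weights_push X : homogeneous_vf d X ->
  (forall i m, m \in msupp (X i 0) -> 0 <= weight i m) ->
  nonneg_weights d nu r (push g X).
Proof.
move=> Xd Xw; have two0 : (2 : F) != 0 by rewrite pnatr_eq0.
have DU : wt_diag (2 : F) \in unitmx.
  by apply: (proj1 (invmx_diag _)) => j; rewrite mxE expfz_neq0.
have hU : g *m wt_diag 2 *m invmx g \in unitmx.
  by rewrite !unitmx_mul gU DU unitmx_inv.
rewrite (vf_monomials X) push_sum.
pose good := nonneg_weights d nu r.
apply: (big_ind good) => [||i _].
- exact: nonneg_weights0.
- move=> Y Z; exact: nonneg_weightsD.
rewrite push_sum big_seq; apply: (big_ind good) => [||m mX].
- exact: nonneg_weights0.
- move=> Y Z; exact: nonneg_weightsD.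
apply: (nonneg_weights_eigen nu_basis hU nu_eigen (Xw i m mX)).
  apply: push_homog => k; rewrite mxE [Y in _ * Y]mxE.
  case: (k == i) => /=; last by rewrite mulr0 dhomog0.
  rewrite mulr1 rpredZ // dhomogX /=; apply/eqP.
  exact: (dhomog_mf (Xd i) mX).
rewrite push_comp // -!mulmxA mulVmx // mulmx1 -push_comp //.
rewrite [Y in push g Y](push_wt_monomial _ _ _ two0).
exact: pushZC.
Qed.

End Destabilise.

Section OnePS.
Variables (F : numFieldType) (g : 'M[F]_3).
Hypothesis gU : g \in unitmx.

Definition wt_ps (t : F) : 'M[F]_3 := g *m wt_diag t *m invmx g.

Lemma det_wt_ps t : t != 0 -> \det (wt_ps t) = 1.
Proof.
move=> t0; rewrite /wt_ps !det_mulmx mulrAC -det_mulmx mulmxV // det1 mul1r.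
rewrite det_diag !big_ord_recl big_ord0 !mxE /e_wt /= mulr1 -!expfzDr //.
Qed.

Lemma wt_psM s t : s != 0 -> t != 0 -> wt_ps (s * t) = wt_ps s *m wt_ps t.
Proof.
move=> s0 t0; rewrite /wt_ps -!mulmxA mulKmx //; congr (_ *m _).
rewrite !mulmxA; congr (_ *m _); rewrite mulmx_diag; congr diag_mx.
by apply/rowP => j; rewrite !mxE expfzMl.
Qed.

(** t^-1 diag(t^3, 1, 1) is a Laurent presentation of diag(t^2, t^-1, t^-1). *)
Lemma wt_ps_laurent : exists (A : 'M[{poly F}]_3) (n : nat),
  forall t, t != 0 -> wt_ps t = t ^- n *: map_mx (fun q => q.[t]) A.
Proof.
pose D : 'rV[{poly F}]_3 := \row_j (if j == 0 then 'X^3 else 1).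
exists (map_mx polyC g *m diag_mx D *m map_mx polyC (invmx g)), 1%N => t t0.
rewrite /wt_ps; have -> : wt_diag t =
    t^-1 *: map_mx (horner_eval t) (diag_mx D).
  apply/matrixP => i j; rewrite !mxE /= /horner_eval /e_wt.
  case: (i == j); last by rewrite mulr0n horner0 mulr0.
  rewrite !mulr1n; case: (i == 0).
    by rewrite hornerXn -exprnP; field.
  by rewrite hornerC mulr1 exprN1.
have ev B : map_mx (horner_eval t) (map_mx polyC B) = B :> 'M[F]_3.
  by apply/matrixP => i j; rewrite !mxE /= /horner_eval hornerC.
transitivity (t^-1 *: map_mx (horner_eval t)
    (map_mx polyC g *m diag_mx D *m map_mx polyC (invmx g))); last by [].
by rewrite !map_mxM !ev -scalemxAr -scalemxAl.
Qed.

Lemma wt_ps_nontrivial : wt_ps 2 != 1%:M.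
Proof.
apply/eqP => E; have : wt_diag (2 : F) = 1%:M.
  have := congr1 (fun A => invmx g *m A *m g) E.
  by rewrite /wt_ps !mulmxA mulVmx // mul1mx -mulmxA mulVmx // !mulmx1 mulVmx.
move/matrixP/(_ 0 0); rewrite !mxE eqxx !mulr1n /e_wt /= -exprnP -natrX => /eqP.
by rewrite pnatr_eq1.
Qed.
End OnePS.

(** * Multiplicities of singular points *)

Lemma eq_mod_euler_pull (F : fieldType) d g (X Y : vf F) : g \in unitmx ->
  eq_mod_euler d (push (invmx g) X) Y -> eq_mod_euler d X (push g Y).
Proof.
move=> gU /(eq_mod_euler_push gU).
by rewrite push_comp ?unitmx_inv // mulmxV // push1.
Qed.

(** A rank one row is a multiple of the first row of its extended row base,
    which is invertible. *)
Lemma exists_unitmx_first_col (F : fieldType) n (p : 'cV[F]_n.+1) : p != 0 ->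
  exists2 g : 'M[F]_n.+1, g \in unitmx & g *m delta_mx 0 0 = p.
Proof.
move=> p0; pose u := p^T; pose c := col_ebase u 0 0.
have u0 : u != 0 by apply: contraNneq p0 => u0; rewrite -[p]trmxK -/u u0 trmx0.
have r1 : \rank u = 1%N by rewrite rank_rV u0.
have c0 : c != 0.
  have := col_ebase_unit u.
  by rewrite unitmxE [col_ebase u]mx11_scalar det_scalar1 unitfE.
exists (c *: row_ebase u)^T.
  by rewrite unitmx_tr unitmxZ ?unitfE // row_ebase_unit.
apply: trmx_inj; rewrite trmx_mul trmxK trmx_delta -/u -[RHS]mulmx_ebase r1.
rewrite [col_ebase u]mx11_scalar -/c -mulmxA mul_scalar_mx -scalemxAr.
congr (_ *: (_ *m _)).
by apply/matrixP => i j; rewrite !mxE ord1; case: j => -[].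
Qed.

Lemma exists_multiplicity (F : fieldType) d (X : vf F) g : g \in unitmx ->
  homogeneous_vf d X -> ~ eq_mod_euler d X 0 ->
  exists n, omin (vanishing_order (local_f (push (invmx g) X)))
                 (vanishing_order (local_g (push (invmx g) X))) = Some n.
Proof.
move=> gU Xd Xne; set Y := push (invmx g) X.
case E: (omin _ _) => [n|]; first by exists n.
case: Xne; rewrite -(push0 g); apply: eq_mod_euler_pull => //.
have order_None (h : {mpoly F[2]}) : vanishing_order h = None -> h = 0.
  by rewrite /vanishing_order; case: eqP.
have Yd : homogeneous_vf d Y by apply: push_homog.
case Ef: (vanishing_order (local_f Y)) E => [k|] /=.
  by case: (vanishing_order (local_g Y)).
by move=> /order_None Eg; apply: (local_eq0 Yd) => //; apply: order_None.
Qed.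

Theorem theorem3p13 (R : realType) (d : nat) (X : vfield R)
    (d_ge2 : (2 <= d)%N) (X_fol : foliation d X) (X_stable : stable d X)
    (X_isol : isolated_singularities X) :
  exists (p : 'cV[R[i]]_3) (m : nat),
    [/\ singular_point X p, algebraic_multiplicity X p m
      & m%:R < (2 * d + 1)%:R / 3 :> rat].
Proof.
have [Xd Xne] := X_fol.
have d0 : (0 < d)%N by apply: leq_trans d_ge2.
have [p Xp] := @exists_singular R[i] d X d0 Xd.
have [g gU gp] := exists_unitmx_first_col (proj1 Xp).
have [n Yn] := @exists_multiplicity R[i] d X g gU Xd Xne.
exists p, n; split; [exact: Xp | by exists g; split |].
(* A large multiplicity would make every weight nonnegative for the subgroup
   below, against stability. *)
rewrite ltr_pdivlMr // -natrM ltr_nat ltnNge; apply/negP => dn.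
have [Y [Yd Yr XY Yf Yg]] := exists_reduced (push_homog (invmx g) Xd).
have Yw := weight_ge0 Yd Yr; rewrite Yf Yg in Yw.
have {}Yw := Yw _ Yn (leq_trans dn (eq_leq (mulnC _ _))).
have [||m] := X_stable (wt_ps g).
- split; [exact: det_wt_ps | exact: wt_psM | exact: wt_ps_laurent].
- by exists 2; [rewrite pnatr_eq0 | apply: wt_ps_nontrivial].
case=> N [nu [r [a [nu_basis nu_eigen Xa [i ai <-] _]]]] /lt_geF/negP; apply.
have two0 : (2 : R[i]) != 0 by rewrite pnatr_eq0.
have [_] := nonneg_weights_push nu_basis gU (fun i => nu_eigen 2 i two0) Yd Yw.
move/(_ a); apply; last exact: ai.
exact: eq_mod_euler_trans (eq_mod_euler_sym (eq_mod_euler_pull gU XY)) Xa.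
Qed.
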